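(* Let $k\ge 0$ and let $G^T$ be the graph obtained from $CC_k$ by replacing each vertex $v_i$ by a set $I(v_i)$ of $m_i$ pairwise adjacent vertices and each vertex $v'_i$ by a set $I(v'_i)$ of $m'_i$ pairwise adjacent vertices (two vertices in different sets are adjacent iff the corresponding vertices of $CC_k$ are adjacent), where $m_0,\dots,m_k\ge 1$, $m'_0,\dots,m'_{k-1}\ge 1$ and $m'_k\ge 0$. Let $\vec m=(m_0,\dots,m_k)$, $\vec m'=(m'_0,\dots,m'_k)$, and write $\sum\vec m=\sum_{j=0}^k m_j$, $\sum\vec m'=\sum_{j=0}^k m'_j$. For $-1\le i\le k$ and integers $0\le x\le\sum_{j=0}^i m_j$, $0\le x'\le\sum_{j=0}^i m'_j$, define $F_i(x,x')$ by $F_{-1}(x,x')=0$ and, for $i\ge 0$, \[ F_i(x,x')=m'_i x'+m_i(x+x')+\max_{\substack{L_i\le s_i\le U_i\\ L'_i\le s'_i\le U'_i}}\Big\{F_{i-1}(x-s_i,x'-s'_i)+s'_i\Big(\sum_{j=0}^{i-1}m'_j-m_i-2x'\Big)+s_i\Big(\sum_{j=0}^{i-1}(m_j+m'_j)-2(x+x')\Big)+(s_i+s'_i)^2\Big\}, \] where $L_i=\max\big(0,x-\sum_{j=0}^{i-1}m_j\big)$, $U_i=\min(m_i,x)$, $L'_i=\max\big(0,x'-\sum_{j=0}^{i-1}m'_j\big)$, $U'_i=\min(m'_i,x')$. Then the maximum cut size of $G^T$ equals \[ \max\{F_k(x,x') : 0\le x\le \textstyle\sum\vec m,\ 0\le x'\le\sum\vec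 m'\}. \]
   Context: For an integer $k\ge 0$, $CC_k$ is the graph with vertex set $\{v_0,\dots,v_k\}\cup\{v'_0,\dots,v'_k\}$, where $\{v_0,\dots,v_k\}$ and $\{v'_0,\dots,v'_k\}$ are cliques and $v_i$ is adjacent to $v'_j$ if and only if $j<i$; there are no other edges. (Every co-bipartite chain graph, i.e. a graph whose vertex set partitions into two cliques $K,K'$ such that the neighborhoods of the vertices of $K$ are linearly ordered by inclusion, arises in this way after contracting classes of twins.) A cut of a graph is a subset $S$ of its vertices; its size is the number of edges with exactly one endpoint in $S$; the maximum cut size is the largest size of a cut. *)

(* Defs.v *)
From HB Require Import structures.
From mathcomp Require Import all_boot all_order all_algebra.
Set Implicit Arguments.
Unset Strict Implicit.
Unset Printing Implicit Defensive.
Import Order.TTheory GRing.Theory Num.Theory.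
Local Open Scope ring_scope.

Record sgraph := SGraph {
  vertex :> finType;
  adj : rel vertex;
  adj_sym : symmetric adj;
  adj_irr : irreflexive adj }.

Definition edges (G : sgraph) : {set {set G}} :=
  [set [set p.1; p.2] | p : G * G & adj p.1 p.2].

Definition cut_size (G : sgraph) (S : {set G}) : nat :=
  #|[set e in edges G | #|e :&: S| == 1%N]|.

Definition maxcut (G : sgraph) : nat := \max_(S : {set G}) cut_size S.

(* inl i encodes v_i and inr i encodes v'_i. *)
Definition CC_adj (k : nat) : rel ('I_k.+1 + 'I_k.+1) := fun u v =>
  match u, v with
  | inl i, inl j => i != j
  | inr i, inr j => i != j
  | inl i, inr j => (j < i)%N
  | inr j, inl i => (j < i)%N
  end.

Lemma CC_adj_sym k : symmetric (@CC_adj k).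
Proof. by move=> [i|i] [j|j] //=; rewrite eq_sym. Qed.

Lemma CC_adj_irr k : irreflexive (@CC_adj k).
Proof. by move=> [i|i] /=; rewrite eqxx. Qed.

Definition CC (k : nat) : sgraph := SGraph (@CC_adj_sym k) (@CC_adj_irr k).

(* The copies of v : G are the w v elements Tagged _ a of tag v, which are
   pairwise adjacent; w v = 0 deletes v. *)
Definition blowup_adj (G : sgraph) (w : G -> nat) : rel {v : G & 'I_(w v)} :=
  fun a b => if tag a == tag b then a != b else adj (tag a) (tag b).

Lemma blowup_adj_sym G w : symmetric (@blowup_adj G w).
Proof.
by move=> a b; rewrite /blowup_adj (eq_sym (tag a)) (eq_sym a) adj_sym.
Qed.

Lemma blowup_adj_irr G w : irreflexive (@blowup_adj G w).
Proof. by move=> a; rewrite /blowup_adj !eqxx. Qed.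

Definition blowup (G : sgraph) (w : G -> nat) : sgraph :=
  SGraph (@blowup_adj_sym G w) (@blowup_adj_irr G w).

Definition CC_weight (k : nat) (m m' : k.+1.-tuple nat) (v : CC k) : nat :=
  match v with
  | inl i => tnth m i
  | inr i => tnth m' i
  end.

Definition GT (k : nat) (m m' : k.+1.-tuple nat) : sgraph :=
  blowup (CC_weight m m').

(* Maximum of f s s' over a <= s <= b and a' <= s' <= b'.  Values may be
   negative, so the iterated maxima start from f a a' instead of 0; see
   max_rectP.  Only meaningful for nonempty ranges. *)
Definition max_rect (a b a' b' : nat) (f : nat -> nat -> int) : int :=
  \big[Num.max/f a a']_(a <= s < b.+1)
    \big[Num.max/f a a']_(a' <= s' < b'.+1) f s s'.

Lemma max_rectP a b a' b' f : (a <= b)%N -> (a' <= b')%N ->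
  (exists s s', [/\ (a <= s <= b)%N, (a' <= s' <= b')%N
                  & max_rect a b a' b' f = f s s'])
  /\ (forall s s', (a <= s <= b)%N -> (a' <= s' <= b')%N ->
        f s s' <= max_rect a b a' b' f).
Proof.
move=> ab ab'; split; last first.
  move=> s s' hs hs'; rewrite /max_rect.
  by apply: (@bigmax_sup_seq _ _ _ _ _ s); rewrite ?mem_index_iota ?ltnS //;
    apply: (@bigmax_sup_seq _ _ _ _ _ s'); rewrite ?mem_index_iota ?ltnS.
pose Q v := exists s s', [/\ (a <= s <= b)%N, (a' <= s' <= b')%N & v = f s s'].
have Q0 : Q (f a a') by exists a, a'; rewrite !leqnn ab ab'.
have Qm u v : Q u -> Q v -> Q (Num.max u v) by rewrite /Num.max; case: ifP.
rewrite -/(Q _) /max_rect big_seq; apply: big_ind => // s.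
rewrite mem_index_iota ltnS => hs; rewrite big_seq; apply: big_ind => // s'.
by rewrite mem_index_iota ltnS => hs'; exists s, s'.
Qed.

(* Index shift: dpF m m' n is the function F_{n-1}, so that F_{-1} = 0 is the
   base case.  The lower bounds (x - M)%N and (x' - M')%N are truncated
   subtractions, i.e. max(0, x - M) and max(0, x' - M'). *)
Fixpoint dpF (k : nat) (m m' : k.+1.-tuple nat) (n x x' : nat) : int :=
  match n with
  | 0 => 0
  | i.+1 =>
    let mi := nth 0%N m i in
    let mi' := nth 0%N m' i in
    let M := (\sum_(j < i) nth 0 m j)%N in
    let M' := (\sum_(j < i) nth 0 m' j)%N in
    mi'%:Z * x'%:Z + mi%:Z * (x%:Z + x'%:Z)
    + max_rect (x - M)%N (minn mi x) (x' - M')%N (minn mi' x')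
        (fun s s' =>
           dpF m m' i (x - s)%N (x' - s')%N
           + s'%:Z * (M'%:Z - mi%:Z - 2 * x'%:Z)
           + s%:Z * ((M%:Z + M'%:Z) - 2 * (x%:Z + x'%:Z))
           + (s%:Z + s'%:Z) ^+ 2)
  end.

(* Main.v *)
(* A cut of a blowup is determined, up to size, by the number of vertices it
   takes in each class, and every choice of these numbers is possible.  For the
   blowup of CC_k, adding the classes v_n and v'_n to those of smaller index
   changes the cut by an amount depending only on the numbers s, s' chosen in
   these two classes and on the totals x, x' chosen so far; this amount is the
   one in the recursion for F_n, and L_n <= s <= U_n, L'_n <= s' <= U'_n say
   exactly that the remaining classes can realise x - s and x' - s'. *)
Require Import Defs.
From mathcomp Require Import all_boot all_order all_algebra.
From mathcomp Require Import zify ring.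

Set Implicit Arguments.
Unset Strict Implicit.
Unset Printing Implicit Defensive.
Import Order.TTheory GRing.Theory Num.Theory.

(** Orienting every cut edge from its end in [S] to its end outside is a bijection, and ordered
    pairs can be counted by double sums. *)
Lemma cut_size_pairs (G : sgraph) (S : {set G}) :
  cut_size S = #|[set p : G * G | [&& adj p.1 p.2, p.1 \in S & p.2 \notin S]]|.
Proof.
rewrite /cut_size.
set A := [set p : G * G | _].
have -> : [set e in edges G | #|e :&: S| == 1] =
    [set [set p.1; p.2] | p in A].
  apply/setP=> e; rewrite inE; apply/andP/imsetP.
    case=> /imsetP[[a b] /= ab ->]; rewrite inE /= in ab.
    have nab : a != b by apply: contraTneq ab => ->; rewrite adj_irr.
    rewrite setIUl cardsU -setIIl.
    have -> : [set a] :&: [set b] = set0.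
      by apply/setP=> x; rewrite !inE; apply/andP=> -[/eqP-> ]; exact/negP.
    rewrite set0I cards0 subn0.
    have c1 x : #|[set x] :&: S| = (x \in S).
      case xS: (x \in S).
        by rewrite (setIidPl _) ?sub1set // cards1.
      apply/eqP; rewrite cards_eq0; apply/eqP/setP=> y; rewrite !inE.
      by apply/andP=> -[/eqP-> ]; rewrite xS.
    rewrite !c1; case aS: (a \in S); case bS: (b \in S) => // _.
      by exists (a, b) => //; rewrite inE /= ab aS bS.
    by exists (b, a); rewrite ?inE /= 1?adj_sym ?ab ?aS ?bS //= setUC.
  case=> -[a b]; rewrite inE /= => /and3P[ab aS bS] ->; split.
    by apply/imsetP; exists (a, b); rewrite ?inE.
  rewrite setIUl (setIidPl _) ?sub1set //.
  have -> : [set b] :&: S = set0.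
    by apply/setP=> y; rewrite !inE; apply/andP=> -[/eqP-> ]; exact/negP.
  by rewrite setU0 cards1.
rewrite card_in_imset // => -[a b] [c d]; rewrite !inE /=.
(* Injectivity: the edge determines its orientation, because exactly one of its ends lies in [S]. *)
move=> /and3P[_ aS bS] /and3P[_ cS dS] /setP E.
have := E a; have := E b; rewrite !inE !eqxx orbT /= => /esym Eb /esym Ea.
have ne x y : x \in S -> y \notin S -> (x == y) = false.
  by move=> xS yS; apply: contraNF yS => /eqP<-.
move: Ea; rewrite (ne a d) // orbF => /eqP ->.
by move: Eb; rewrite eq_sym (ne c b) //= => /eqP ->.
Qed.

Definition trace_card (G : sgraph) (w : G -> nat) (S : {set blowup w}) (v : G)
    : nat :=
  #|[set a : 'I_(w v) | Tagged (fun v => 'I_(w v)) a \in S]|.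

Definition blowup_cut_value (G : sgraph) (w s : G -> nat) : nat :=
  \sum_u \sum_v ((u == v) || adj u v) * (s u * (w v - s v)).

Lemma trace_card_le (G : sgraph) (w : G -> nat) (S : {set blowup w}) v :
  trace_card S v <= w v.
Proof. by rewrite -[leqRHS]card_ord max_card. Qed.

Lemma sum_blowup (G : sgraph) (w : G -> nat) (F : blowup w -> nat) :
  \sum_p F p = \sum_v \sum_(a : 'I_(w v)) F (Tagged (fun v => 'I_(w v)) a).
Proof.
rewrite (@sig_big_dep _ _ _ _ (fun v => 'I_(w v)) xpredT (fun _ => xpredT)
  (fun v a => F (Tagged (fun v => 'I_(w v)) a))) /=.
by apply: eq_bigr => -[v a] _.
Qed.

(* Two vertices on different sides of a cut are distinct, so each class of
   the blowup can be treated as if it had loops. *)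
Lemma cut_size_blowup (G : sgraph) (w : G -> nat) (S : {set blowup w}) :
  cut_size S = blowup_cut_value w (trace_card S).
Proof.
pose T v (a : 'I_(w v)) : blowup w := Tagged (fun v => 'I_(w v)) a.
rewrite cut_size_pairs -sum1dep_card big_mkcond /=.
rewrite -(pair_bigA _ (fun a b : blowup w =>
  if [&& adj a b, a \in S & b \notin S] then 1 else 0)) /=.
rewrite sum_blowup; apply: eq_bigr => u _.
rewrite (eq_bigr _ (fun a _ => sum_blowup _)).
rewrite exchange_big; apply: eq_bigr => v _ /=.
have -> : trace_card S u = \sum_(a < w u) (T u a \in S).
  rewrite /trace_card -sum1dep_card big_mkcond.
  by apply: eq_bigr => a _; case: ifP.
have -> : w v - trace_card S v = \sum_(b < w v) (T v b \notin S).
  rewrite -[w v in LHS]card_ord -(cardC [set a | T v a \in S]) addKn.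
  rewrite -sum1_card big_mkcond; apply: eq_bigr => b _.
  by rewrite !inE; case: ifP.
rewrite big_distrlr big_distrr /=; apply: eq_bigr => a _.
rewrite big_distrr /=; apply: eq_bigr => b _.
rewrite -/(T u a) -/(T v b) /blowup_adj /=.
case aS: (T u a \in S); case bS: (T v b \in S); rewrite ?andbF ?muln0 //=.
rewrite andbT muln1; case: (eqVneq u v) => [uv|_] /=; last by case: adj.
case: eqP => // E; by rewrite -E aS in bS.
Qed.

(** Take the first [s v] copies in each class. *)
Lemma blowup_trace (G : sgraph) (w s : G -> nat) : (forall v, s v <= w v) ->
  exists S : {set blowup w}, forall v, trace_card S v = s v.
Proof.
move=> sw; exists [set p : blowup w | tagged p < s (tag p)] => v.
rewrite /trace_card -sum1dep_card.
under eq_bigl do rewrite inE /=.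
by rewrite -(big_ord_widen _ (fun=> 1)) // sum1_card card_ord.
Qed.

(** Cut sizes depend only on the class counts and all counts up to [w] occur, so maximising over
    vertex sets amounts to maximising over counts. *)
Lemma maxcut_blowup (G : sgraph) (w : G -> nat) (n : nat) :
  (forall s, (forall v, s v <= w v) -> blowup_cut_value w s <= n) ->
  (exists2 s, (forall v, s v <= w v) & blowup_cut_value w s = n) ->
  maxcut (blowup w) = n.
Proof.
move=> ub [s sw sn]; apply/eqP; rewrite eqn_leq; apply/andP; split.
  apply/bigmax_leqP => S _; rewrite cut_size_blowup.
  by apply: ub => v; exact: trace_card_le.
have [S ES] := blowup_trace sw; apply: leq_trans (leq_bigmax S).
rewrite cut_size_blowup -sn /blowup_cut_value.
by under [X in _ <= X]eq_bigr => u _ do under eq_bigr => v _ do rewrite !ES.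
Qed.

(* The cut of the blowup of [CC n.-1] with [s i] and [s' i] vertices of
   I(v_i) and I(v'_i) on one side, [c i] and [c' i] on the other. *)
Definition chain_cut (s c s' c' : nat -> nat) (n : nat) : nat :=
  \sum_(i < n) \sum_(j < n) (s i * c j + s' i * c' j
    + (j < i) * (s i * c' j) + (i < j) * (s' i * c j)).

(** The double sum splits into the square below [n], the last row, the last column and the corner.
    Among the classes of index at most [n], v_n sees every v'_j with [j < n], whereas v'_n sees no
    v_j; hence the asymmetric last summand. *)
Lemma chain_cutS (s c s' c' : nat -> nat) (n : nat) :
  chain_cut s c s' c' n.+1 = chain_cut s c s' c' n
  + (s n * (\sum_(j < n) c j + c n) + (\sum_(j < n) s j) * c n)
  + (s' n * (\sum_(j < n) c' j + c' n) + (\sum_(j < n) s' j) * c' n)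
  + (s n * \sum_(j < n) c' j + (\sum_(j < n) s' j) * c n).
Proof.
rewrite /chain_cut big_ord_recr /=.
under eq_bigr do rewrite big_ord_recr /=.
rewrite big_split /= big_ord_recr /= !ltnn !mul0n !addn0.
have -> : \sum_(i < n) (s i * c n + s' i * c' n + (n < i) * (s i * c' n) +
    (i < n) * (s' i * c n)) = (\sum_(j < n) s j) * c n +
    (\sum_(j < n) s' j) * c' n + (\sum_(j < n) s' j) * c n.
  rewrite !big_distrl /= -!big_split /=; apply: eq_bigr => i _.
  by rewrite ltn_ord ltnNge (ltnW (ltn_ord i)) /= mul0n addn0 mul1n.
have -> : \sum_(j < n) (s n * c j + s' n * c' j + (j < n) * (s n * c' j) +
    (n < j) * (s' n * c j)) = s n * (\sum_(j < n) c j) +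
    s' n * (\sum_(j < n) c' j) + s n * (\sum_(j < n) c' j).
  rewrite !big_distrr /= -!big_split /=; apply: eq_bigr => i _.
  by rewrite ltn_ord (ltnNge n) (ltnW (ltn_ord i)) /= mul0n addn0 mul1n.
ring.
Qed.

Lemma blowup_cut_value_CC (k : nat) (m m' : k.+1.-tuple nat)
    (s s' : nat -> nat) (t : CC k -> nat) :
  (forall i : 'I_k.+1, t (inl i) = s i) ->
  (forall i : 'I_k.+1, t (inr i) = s' i) ->
  blowup_cut_value (CC_weight m m') t =
  chain_cut s (fun i => nth 0 m i - s i) s' (fun i => nth 0 m' i - s' i) k.+1.
Proof.
move=> ts ts'; rewrite /blowup_cut_value /chain_cut big_sumType /= -big_split.
apply: eq_bigr => i _ /=; rewrite !big_sumType /= -!big_split /=.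
apply: eq_bigr => j _; rewrite !ts !ts' !(tnth_nth 0).
have inlE x y : (@inl 'I_k.+1 'I_k.+1 x == inl y) = (x == y) by [].
have inrE x y : (@inr 'I_k.+1 'I_k.+1 x == inr y) = (x == y) by [].
(* Inside either clique, being equal or adjacent always holds. *)
by rewrite inlE inrE !orbN !mul1n; ring.
Qed.

Section Recursion.
Local Open Scope ring_scope.

(** Rewrites the increment in terms of the new totals [X + y] and [X' + y'], the arguments x and x'
    of the recursion. The bounds make the truncated subtractions exact in the integers. *)
Lemma chain_cut_stepE (C M M' X X' mn mn' y y' : nat) :
  (X <= M)%N -> (X' <= M')%N -> (y <= mn)%N -> (y' <= mn')%N ->
  (C + (y * ((M - X) + (mn - y)) + X * (mn - y))
     + (y' * ((M' - X') + (mn' - y')) + X' * (mn' - y'))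
     + (y * (M' - X') + X' * (mn - y)))%N%:Z =
  mn'%:Z * (X' + y')%:Z + mn%:Z * ((X + y)%:Z + (X' + y')%:Z) +
  (C%:Z + y'%:Z * (M'%:Z - mn%:Z - 2 * (X' + y')%:Z)
   + y%:Z * ((M%:Z + M'%:Z) - 2 * ((X + y)%:Z + (X' + y')%:Z))
   + (y%:Z + y'%:Z) ^+ 2).
Proof.
move=> XM XM' ym ym'; rewrite !(PoszD, PoszM) -!subzn //.
ring.
Qed.

Lemma sum_complement (a s : nat -> nat) (n : nat) :
  (forall i, i < n -> s i <= a i)%N ->
  (\sum_(i < n) (a i - s i))%N = (\sum_(i < n) a i - \sum_(i < n) s i)%N.
Proof. by move=> sa; rewrite sumnB // => i _; apply: sa. Qed.

(** By induction: the counts in the last two classes are admissible for the maximum in the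
    recursion, which therefore dominates the resulting cut. *)
Lemma dpF_ge_chain_cut (k : nat) (m m' : k.+1.-tuple nat) (s s' : nat -> nat)
    (n : nat) :
  (forall i, i < n -> s i <= nth 0 m i)%N ->
  (forall i, i < n -> s' i <= nth 0 m' i)%N ->
  (chain_cut s (fun i => nth 0 m i - s i) s' (fun i => nth 0 m' i - s' i) n)%N%:Z
  <= dpF m m' n (\sum_(i < n) s i)%N (\sum_(i < n) s' i)%N.
Proof.
elim: n => [|n IHn] sm sm'; first by rewrite /chain_cut big_ord0.
have {}IHn := IHn (fun i h => sm i (ltnW h)) (fun i h => sm' i (ltnW h)).
have XM : (\sum_(i < n) s i <= \sum_(i < n) nth 0 m i)%N.
  by apply: leq_sum => i _; apply/sm/ltnW/ltn_ord.
have XM' : (\sum_(i < n) s' i <= \sum_(i < n) nth 0 m' i)%N.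
  by apply: leq_sum => i _; apply/sm'/ltnW/ltn_ord.
rewrite chain_cutS !sum_complement; try by move=> i h; auto.
have ym := sm n (ltnSn n); have ym' := sm' n (ltnSn n).
rewrite chain_cut_stepE // !big_ord_recr /=; rewrite lerD2l.
set f := (X in max_rect _ _ _ _ X).
set X := (\sum_(i < n) s i)%N in XM IHn f *.
set X' := (\sum_(i < n) s' i)%N in XM' IHn f *.
set M := (\sum_(i < n) nth 0 m i)%N in XM f *.
set M' := (\sum_(i < n) nth 0 m' i)%N in XM' f *.
(* The lower bound is [X <= M]; the upper one is the size of the class. *)
have r : (X + s n - M <= s n <= minn (nth 0 m n) (X + s n))%N by lia.
have r' : (X' + s' n - M' <= s' n <= minn (nth 0 m' n) (X' + s' n))%N by lia.
have /andP[r1 r2] := r; have /andP[r1' r2'] := r'.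
have [_ /(_ _ _ r r')] := max_rectP f (leq_trans r1 r2) (leq_trans r1' r2').
apply: le_trans.
by rewrite /f !addnK -/M -/M' !lerD2r.
Qed.

(** Backtracking: a maximiser of the last step gives the counts in the last two classes, and the
    induction hypothesis gives the others. *)
Lemma dpF_attained (k : nat) (m m' : k.+1.-tuple nat) (n x x' : nat) :
  (x <= \sum_(i < n) nth 0 m i)%N -> (x' <= \sum_(i < n) nth 0 m' i)%N ->
  exists s s' : nat -> nat,
  [/\ (forall i, i < n -> s i <= nth 0 m i)%N,
      (forall i, i < n -> s' i <= nth 0 m' i)%N,
      (\sum_(i < n) s i)%N = x, (\sum_(i < n) s' i)%N = x' &
      (chain_cut s (fun i => nth 0 m i - s i)
         s' (fun i => nth 0 m' i - s' i) n)%N%:Z = dpF m m' n x x'].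
Proof.
elim: n x x' => [|n IHn] x x'.
  rewrite !big_ord0 !leqn0 => /eqP-> /eqP->.
  by exists (fun=> 0%N), (fun=> 0%N); rewrite /chain_cut !big_ord0.
rewrite !big_ord_recr /= => xM xM'.
set f := (X in max_rect _ _ _ _ X).
set M := (\sum_(i < n) nth 0 m i)%N in xM f *.
set M' := (\sum_(i < n) nth 0 m' i)%N in xM' f *.
have r : (x - M <= minn (nth 0 m n) x)%N by lia.
have r' : (x' - M' <= minn (nth 0 m' n) x')%N by lia.
have [[y [y' [hy hy' ->]]] _] := max_rectP f r r'.
(* [x - M <= y] means that the remaining total [x - y] fits into the earlier classes; likewise for
   [x']. *)
have [||s [s' [sm sm' sx sx' E]]] := IHn (x - y)%N (x' - y')%N;
  rewrite -?/M -?/M'; try lia.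
(* Only the value at [n] changes, so sums and cuts below [n] are preserved. *)
pose ext (u : nat -> nat) z i := if i == n then z else u i.
have extn u z : ext u z n = z by rewrite /ext eqxx.
have extlt u z i : (i < n)%N -> ext u z i = u i.
  by move=> lin; rewrite /ext ltn_eqF.
have sumext u z : (\sum_(i < n) ext u z i = \sum_(i < n) u i)%N.
  by apply: eq_bigr => i _; rewrite extlt.
exists (ext s y), (ext s' y').
have le1 i : (i < n.+1 -> ext s y i <= nth 0 m i)%N.
  rewrite ltnS leq_eqVlt => /orP[/eqP->|h]; first by rewrite extn; lia.
  by rewrite extlt //; apply: sm.
have le2 i : (i < n.+1 -> ext s' y' i <= nth 0 m' i)%N.
  rewrite ltnS leq_eqVlt => /orP[/eqP->|h]; first by rewrite extn; lia.
  by rewrite extlt //; apply: sm'.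
split=> //; try by rewrite big_ord_recr /= sumext extn ?sx ?sx'; lia.
rewrite chain_cutS !sum_complement; try by move=> i h; auto.
rewrite !sumext !extn sx sx' -/M -/M' chain_cut_stepE; try lia.
rewrite /f -E !subnK; try lia.
congr (_ + (_ + _ + _ + _)); congr Posz.
by apply: eq_bigr => i _; apply: eq_bigr => j _; rewrite !extlt.
Qed.

End Recursion.

Theorem theorem3 (k : nat) (m m' : k.+1.-tuple nat)
    (hm : forall i : 'I_k.+1, 1 <= tnth m i)
    (hm' : forall i : 'I_k.+1, i < k -> 1 <= tnth m' i) :
  Posz (maxcut (GT m m')) =
  max_rect 0 (\sum_(j < k.+1) tnth m j) 0 (\sum_(j < k.+1) tnth m' j)
    (dpF m m' k.+1).
Proof.
have sumE (t : k.+1.-tuple nat) :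
    \sum_(j < k.+1) tnth t j = \sum_(j < k.+1) nth 0 t j.
  by apply: eq_bigr => j _; rewrite (tnth_nth 0).
rewrite !sumE.
have [[x [x' [hx hx' Emax]]] ub] := max_rectP (dpF m m' k.+1)
  (leq0n (\sum_(j < k.+1) nth 0 m j)) (leq0n (\sum_(j < k.+1) nth 0 m' j)).
(* Counts realising the optimal totals give the cut of maximum size; every other cut is bounded by
   F_k at its own totals. *)
have [s [s' [sm sm' _ _ Ecut]]] := dpF_attained hx hx'.
rewrite Emax -Ecut in ub *; congr Posz; apply: maxcut_blowup => [t tw|].
  (* Extends the counts to all naturals; only indices up to [k] enter the cut. *)
  pose u i := t (inl (inord i)); pose u' i := t (inr (inord i)).
  have um i : i < k.+1 -> u i <= nth 0 m i.
    by move=> h; have := tw (inl (inord i)); rewrite /= (tnth_nth 0) inordK.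
  have um' i : i < k.+1 -> u' i <= nth 0 m' i.
    by move=> h; have := tw (inr (inord i)); rewrite /= (tnth_nth 0) inordK.
  rewrite (@blowup_cut_value_CC _ _ _ u u') => [|i|i];
    [|by rewrite /u inord_val|by rewrite /u' inord_val].
  rewrite -lez_nat; apply: le_trans (dpF_ge_chain_cut um um') (ub _ _ _ _).
    by apply: leq_sum => i _; apply: um.
  by apply: leq_sum => i _; apply: um'.
exists (fun v : CC k => match v with inl i => s i | inr i => s' i end).
  by case=> i /=; rewrite (tnth_nth 0); [apply: sm|apply: sm'].
exact: blowup_cut_value_CC.
Qed.
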